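(* Let $p\in(0,1)$ be a constant (independent of $n$). (i) If $p<2-\sqrt2$, then the probability that $P^n_{3,p}$ is connected tends to $0$ as $n\to\infty$. (ii) If $p>2-\sqrt2$, then the probability that $P^n_{3,p}$ has no isolated vertex tends to $1$ as $n\to\infty$.
   Context: $P_3$ is the path with 3 vertices (length 2). For a positive integer $n$, $P_3^n$ is the Cartesian product of $n$ copies of $P_3$: its vertices are the vectors $x=(x_1,\dots,x_n)\in\{0,1,2\}^n$, and $x,y$ are adjacent if and only if there is an index $i$ with $|x_i-y_i|=1$ and $x_j=y_j$ for all $j\ne i$. The random subgraph $P^n_{3,p}$ contains all vertices of $P_3^n$ and each edge of $P_3^n$ independently with probability $p$. A vertex is isolated if it has no incident edge in the random subgraph. *)

(* Defs.v *)
From mathcomp Require Import all_boot all_order all_algebra.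
From mathcomp Require Import all_classical all_reals all_analysis.
Set Implicit Arguments.
Unset Strict Implicit.
Unset Printing Implicit Defensive.
Import Order.TTheory GRing.Theory Num.Theory.
Import numFieldNormedType.Exports.
Local Open Scope ring_scope.

Section RandomSubgraph.
Variable T : finType.
Implicit Types (e : rel T) (S : {set {set T}}).

(* A simple graph on T is a symmetric irreflexive relation; its edges are
   the unordered pairs [set x; y] of adjacent vertices. *)
Definition edge_set e : {set {set T}} :=
  [set f : {set T} | [exists x, exists y, e x y && (f == [set x; y])]].

(* A spanning subgraph is represented by its set S of edges. *)
Definition adj_in S : rel T := [rel x y | [set x; y] \in S].

Definition connected_graph S : bool :=
  [forall x, forall y, connect (adj_in S) x y].

Definition isolated S (x : T) : bool := [forall f in S, x \notin f].

Definition no_isolated_vertex S : bool := [forall x, ~~ isolated S x].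

Variable R : realType.

(* Law of bond percolation: the edges of e are kept independently, each with
   probability p, so a set S of edges is the outcome with the product weight. *)
Definition subgraph_weight e (p : R) S : R :=
  \prod_(f in edge_set e) (if f \in S then p else 1 - p).

Definition subgraph_prob e (p : R) (A : pred {set {set T}}) : R :=
  \sum_(S in powerset (edge_set e) | A S) subgraph_weight e p S.

End RandomSubgraph.

Definition P3n_vertex (n : nat) : finType := {ffun 'I_n -> 'I_3}.

Definition P3n_adj (n : nat) : rel (P3n_vertex n) := [rel x y : P3n_vertex n |
  [exists i, (`|(x i : nat) - (y i : nat)|%N == 1%N) &&
             [forall j, (j != i) ==> (x j == y j)]]].
Arguments P3n_adj n : clear implicits.

(* Main.v *)
Require Import Defs.
From mathcomp Require Import all_boot all_order all_algebra.
From mathcomp Require Import all_classical all_reals all_analysis.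
From mathcomp Require Import zify ring lra.
Import Order.TTheory GRing.Theory Num.Theory.
Import numFieldNormedType.Exports.
(* [all_classical] and [all_analysis] shadow the finite-set lemmas and [isolated]. *)
Import fintype boot.finset Defs.
Local Open Scope ring_scope.

(** With q = 1 - p, a vertex with k coordinates equal to 1 has degree n + k, so
    the expected number of isolated vertices is (2 q + q^2)^n = ((2 - p)^2 - 1)^n.
    The base is below 1 exactly when p > 2 - sqrt 2, and then Markov's inequality
    applies. When the base exceeds 1, vertices that are neither equal nor adjacent
    share no edge, so their isolation is independent; the variance is then at most
    (2 n + 1) times the mean, and Chebyshev's inequality yields an isolated vertex
    with probability tending to 1. *)

(** * Isolation in bond percolation on a finite graph *)

Section IsolatedVertices.
Variables (T : finType) (e : rel T).
Implicit Types (x y : T) (S B : {set {set T}}).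

Definition incident_edges x : {set {set T}} := [set f in edge_set e | x \in f].

(** Recasts isolation as avoidance of a fixed edge set, the kind of event whose probability
    [sum_weight_disjoint] gives. *)
Lemma isolatedE S x : S \subset edge_set e ->
  isolated S x = [disjoint S & incident_edges x].
Proof.
move=> /subsetP sSE; apply/forallP/pred0P => [iso f | dis f] /=.
  rewrite inE; apply/negP => /and3P[fS _ xf].
  by have := iso f; rewrite fS xf.
apply/implyP => fS; apply/negP => xf.
by have := dis f; rewrite /= inE fS xf sSE.
Qed.

Hypotheses (e_sym : symmetric e) (e_irr : irreflexive e).

Lemma incident_edgesE x :
  incident_edges x = [set [set x; y] | y in [set y | e x y]].
Proof.
apply/setP => f; apply/idP/imsetP => [|[y]].
  rewrite !inE => /andP[/existsP[u /existsP[v /andP[euv /eqP ->]]]].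
  rewrite !inE => /orP[]/eqP ->; first by exists v; rewrite ?inE.
  by exists u; rewrite ?inE 1?e_sym // setUC.
rewrite inE => exy ->; rewrite !inE eqxx andbT.
by apply/existsP; exists x; apply/existsP; exists y; rewrite exy eqxx.
Qed.

Lemma card_incident_edges x : #|incident_edges x| = #|[set y | e x y]|.
Proof.
rewrite incident_edgesE card_in_imset // => y z; rewrite !inE => exy exz /setP.
move=> /(_ y); rewrite !inE eqxx orbT => /esym/orP[]/eqP // yx.
by rewrite yx e_irr in exy.
Qed.

(** A shared edge would contain both [x] and [y], hence be the pair itself. *)
Lemma incident_edges_disjoint x y : x != y -> ~~ e x y ->
  [disjoint incident_edges x & incident_edges y].
Proof.
move=> xy nexy; apply/pred0P => f /=; apply/negP => /andP[].
rewrite incident_edgesE => /imsetP[z]; rewrite inE => exz ->.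
rewrite !inE => /andP[_]; rewrite eq_sym (negPf xy) /= => /eqP yz.
by rewrite yz exz in nexy.
Qed.

Variables (R : realType) (p : R).
Hypotheses (p_ge0 : 0 <= p) (p_le1 : p <= 1).

Let q_ge0 : 0 <= 1 - p. Proof. by rewrite subr_ge0. Qed.
Let q_le1 : 1 - p <= 1. Proof. by rewrite lerBlDr lerDl. Qed.

Lemma subgraph_weight_ge0 S : 0 <= subgraph_weight e p S.
Proof. by apply: prodr_ge0 => f _; case: ifP. Qed.

Lemma sum_weight_disjoint B : B \subset edge_set e ->
  \sum_(S in powerset (edge_set e)) subgraph_weight e p S *
    [disjoint S & B]%:R = (1 - p) ^+ #|B|.
Proof.
move=> sBE; set E := edge_set e.
(* Distributing the product of [F f + G f] yields a sum over all [S]. [F] weighs presence and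
   vanishes on [B] and off [E], which kills the unwanted [S]; [G] weighs absence and is neutral off
   [E]. The sum is [1 - p] on [B] and 1 elsewhere. *)
pose F f : R := if f \in E :\: B then p else 0.
pose G f : R := if f \in E then 1 - p else 1.
transitivity (\prod_f (F f + G f)); last first.
  rewrite (bigID (mem B)) /= [X in _ * X]big1 => [|f nfB].
    rewrite mulr1 (eq_bigr (fun=> 1 - p)) ?prodr_const // => f fB.
    by rewrite /F /G in_setD fB (subsetP sBE) //= add0r.
  rewrite /F /G in_setD nfB /=; case: ifP => _; last by rewrite add0r.
  by rewrite addrC subrK.
rewrite bigA_distr /= big_mkcond /=; apply: eq_bigr => S _.
rewrite powersetE; have [sSE|/subsetPn[f fS nfE]] := boolP (S \subset E); last first.
  by rewrite (bigD1 f) //= fS /F in_setD (negPf nfE) andbF mul0r.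
have [dSB|] := boolP [disjoint S & B]; last first.
  rewrite -setI_eq0 => /set0Pn[f]; rewrite inE => /andP[fS fB].
  by rewrite mulr0 (bigD1 f) //= fS /F in_setD fB mul0r.
rewrite mulr1 /subgraph_weight -/E [LHS]big_mkcond /=; apply: eq_bigr => f _.
rewrite /F /G in_setD; case: (boolP (f \in S)) => fS.
  by rewrite (subsetP sSE f fS) (disjointFr dSB fS).
by [].
Qed.

Lemma sum_weight :
  \sum_(S in powerset (edge_set e)) subgraph_weight e p S = 1.
Proof.
rewrite -[RHS](expr0 (1 - p)) -(cards0 {set T}) -sum_weight_disjoint ?sub0set//.
apply: eq_bigr => S _; have -> : [disjoint S & set0]; last by rewrite mulr1.
by rewrite -setI_eq0 setI0.
Qed.

Lemma subgraph_probE (A : pred {set {set T}}) :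
  subgraph_prob e p A =
  \sum_(S in powerset (edge_set e)) subgraph_weight e p S * (A S)%:R.
Proof.
rewrite /subgraph_prob big_mkcondr /=; apply: eq_bigr => S _.
by case: (A S); rewrite ?mulr1 ?mulr0.
Qed.

Lemma subgraph_prob_ge0 (A : pred {set {set T}}) : 0 <= subgraph_prob e p A.
Proof. by apply: sumr_ge0 => S _; exact: subgraph_weight_ge0. Qed.

Lemma le_subgraph_prob (A B : pred {set {set T}}) :
  (forall S, A S -> B S) -> subgraph_prob e p A <= subgraph_prob e p B.
Proof.
move=> AB; rewrite !subgraph_probE; apply: ler_sum => S _.
rewrite ler_wpM2l ?subgraph_weight_ge0 // ler_nat.
by have := AB S; case: (A S) => // ->.
Qed.

Lemma subgraph_prob_le1 (A : pred {set {set T}}) : subgraph_prob e p A <= 1.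
Proof.
apply: le_trans (_ : _ <= subgraph_prob e p predT) _; first exact: le_subgraph_prob.
rewrite subgraph_probE -[leRHS]sum_weight.
by under eq_bigr do rewrite mulr1.
Qed.

(** A path from an isolated vertex to a second vertex would lack a first edge. *)
Lemma connected_graph_no_isolated_vertex S :
  (1 < #|T|)%N -> connected_graph S -> no_isolated_vertex S.
Proof.
move=> T_gt1 cS; apply/forallP => x; apply/negP => /forallP iso.
have /card_gt0P[y] : (0 < #|[set~ x]|)%N by rewrite cardsC1; lia.
rewrite !inE => yx; have /connectP[s] := forallP (forallP cS x) y.
case: s => [_ /esym/eqP|z s /= /andP[xzS _] _]; first by rewrite eq_sym (negPf yx).
by have := iso [set x; z]; rewrite !inE eqxx; move: xzS; rewrite /adj_in /= => ->.
Qed.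

(** * First and second moments of the number of isolated vertices *)

Definition num_isolated S : nat := (\sum_x isolated S x)%N.

Definition mean_isolated : R := \sum_x (1 - p) ^+ #|incident_edges x|.

Lemma no_isolated_vertexE S : no_isolated_vertex S = (num_isolated S == 0)%N.
Proof.
rewrite /num_isolated sum_nat_eq0; apply: eq_forallb => x /=.
by rewrite eqb0.
Qed.

Lemma sum_weight_num_isolated :
  \sum_(S in powerset (edge_set e)) subgraph_weight e p S * (num_isolated S)%:R =
  mean_isolated.
Proof.
under eq_bigr do rewrite natr_sum mulr_sumr.
rewrite exchange_big; apply: eq_bigr => x _ /=.
rewrite -sum_weight_disjoint; last by apply/subsetP => f; rewrite inE => /andP[].
by apply: eq_bigr => S; rewrite powersetE => sSE; rewrite isolatedE.
Qed.

(** Markov: for a natural number k, 1 - k is at most the indicator of k = 0; take expectations. *)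
Lemma prob_no_isolated_vertex_ge :
  1 - mean_isolated <= subgraph_prob e p (@no_isolated_vertex T).
Proof.
rewrite -sum_weight_num_isolated -[X in X - _]sum_weight -sumrB subgraph_probE.
apply: ler_sum => S _; rewrite -{1}[subgraph_weight e p S]mulr1 -mulrBr.
rewrite ler_wpM2l ?subgraph_weight_ge0 // no_isolated_vertexE.
case: (num_isolated S) => [|k] /=; first by rewrite subr0.
by rewrite subr_le0 ler1n.
Qed.

Lemma sum_weight_num_isolated_sqr (D : nat) :
  (forall x, #|incident_edges x| <= D)%N ->
  \sum_(S in powerset (edge_set e))
     subgraph_weight e p S * (num_isolated S)%:R ^+ 2 <=
  mean_isolated ^+ 2 + mean_isolated * (D.+1)%:R.
Proof.
move=> degD; have sub_inc x : incident_edges x \subset edge_set e.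
  by apply/subsetP => f; rewrite inE => /andP[].
(* Two vertices are both isolated exactly when [S] avoids the union of their incident edges. *)
have -> : \sum_(S in powerset (edge_set e))
     subgraph_weight e p S * (num_isolated S)%:R ^+ 2 =
  \sum_x \sum_y (1 - p) ^+ #|incident_edges x :|: incident_edges y|.
  under eq_bigr => S _ do rewrite natr_sum expr2 big_distrlr /= mulr_sumr.
  rewrite exchange_big; apply: eq_bigr => x _ /=.
  under eq_bigr => S _ do rewrite mulr_sumr.
  rewrite exchange_big; apply: eq_bigr => y _ /=.
  rewrite -sum_weight_disjoint; last by rewrite subUset !sub_inc.
  apply: eq_bigr => S; rewrite powersetE => sSE; rewrite !isolatedE // -natrM mulnb.
  by rewrite -!setI_eq0 setIUr setU_eq0.
rewrite expr2 big_distrlr /= mulr_suml -big_split /=.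
apply: ler_sum => x _.
(* Outside the closed neighbourhood [N] of [x] the exponents add up, giving the terms of the squared
   mean. Each of the at most [D.+1] terms inside is bounded by the probability that [x] alone is
   isolated. *)
pose N := [set y | (x == y) || e x y].
have cardN : (#|N| <= D.+1)%N.
  apply: leq_trans (_ : #|x |: [set y | e x y]| <= _)%N.
    by apply: subset_leq_card; apply/subsetP => y; rewrite !inE eq_sym.
  rewrite cardsU1 -card_incident_edges -[D.+1]add1n leq_add //; exact: leq_b1.
rewrite (bigID (mem N)) /= addrC lerD //.
  rewrite [leRHS](bigID (mem N)) /= ler_wpDl //.
    by apply: sumr_ge0 => y _; rewrite mulr_ge0 ?exprn_ge0.
  apply: ler_sum => y; rewrite inE negb_or => /andP[xy nexy].
  rewrite -exprD cardsU disjoint_setI0 ?cards0 ?subn0 //.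
  exact: incident_edges_disjoint.
apply: le_trans (_ : _ <= \sum_(y in N) (1 - p) ^+ #|incident_edges x|) _.
  apply: ler_sum => y _; rewrite ler_wiXn2l //.
  by rewrite subset_leq_card // subsetUl.
by rewrite sumr_const -[leLHS]mulr_natr ler_wpM2l ?exprn_ge0 // ler_nat.
Qed.

(* Chebyshev's inequality for [num_isolated]. *)
Lemma prob_no_isolated_vertex_le (D : nat) : 0 < mean_isolated ->
  (forall x, #|incident_edges x| <= D)%N ->
  subgraph_prob e p (@no_isolated_vertex T) <= (D.+1)%:R / mean_isolated.
Proof.
move=> m_gt0 degD; set m := mean_isolated in m_gt0 *.
rewrite ler_pdivlMr // -(ler_pM2r m_gt0) -mulrA -expr2.
(* With denominators cleared, the left side is the probability times [m ^+ 2]. On the event the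
   count is 0, so its squared deviation is [m ^+ 2], and the variance dominates. *)
apply: le_trans (_ : _ <= \sum_(S in powerset (edge_set e))
     subgraph_weight e p S * ((num_isolated S)%:R - m) ^+ 2) _.
  rewrite subgraph_probE mulr_suml; apply: ler_sum => S _.
  rewrite -mulrA ler_wpM2l ?subgraph_weight_ge0 // no_isolated_vertexE.
  by case: eqP => [->|_]; rewrite ?mul1r ?sub0r ?sqrrN ?mul0r ?sqr_ge0.
rewrite [leLHS](_ : _ = \sum_(S in powerset (edge_set e))
     subgraph_weight e p S * (num_isolated S)%:R ^+ 2 - m ^+ 2).
  rewrite lerBlDl (le_trans (sum_weight_num_isolated_sqr _ degD)) //.
  by rewrite [_ * m]mulrC.
pose w S := subgraph_weight e p S; pose X S : R := (num_isolated S)%:R.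
under eq_bigr => S _.
  rewrite (_ : _ * _ = w S * X S ^+ 2 - w S * X S * (m *+ 2) + w S * m ^+ 2).
    over.
  rewrite -/(w S) -/(X S); ring.
rewrite big_split sumrB /= -!mulr_suml sum_weight sum_weight_num_isolated -/m.
ring.
Qed.

End IsolatedVertices.

(** * Degrees and the mean in the power of the path *)

Lemma P3n_adj_sym (n : nat) : symmetric (P3n_adj n).
Proof.
move=> x y; apply: eq_existsb => i; rewrite distnC. congr (_ && _).
by apply: eq_forallb => j; rewrite [x j == _]eq_sym.
Qed.

Lemma P3n_adj_irr (n : nat) : irreflexive (P3n_adj n).
Proof. by move=> x; apply/existsP => -[i]; rewrite distnn. Qed.

Lemma card_P3n_neighbours (n : nat) (x : P3n_vertex n) :
  #|[set y | P3n_adj n x y]| = (\sum_i (1 + (x i == 1%N :> nat)))%N.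
Proof.
(* A neighbour is determined by the coordinate that moves and its new value: two choices from the
   middle value 1, one from an end. *)
pose step (u : 'I_n * 'I_3) : P3n_vertex n :=
  [ffun j => if j == u.1 then u.2 else x j].
pose near_coord i (c : 'I_3) := (`|(x i : nat) - (c : nat)|%N == 1%N).
have -> : [set y | P3n_adj n x y] = [set step u | u in [set u | near_coord u.1 u.2]].
  apply/setP => y; rewrite inE; apply/existsP/imsetP => [[i /andP[xyi /forallP yx]]|].
    exists (i, y i); first by rewrite inE.
    apply/ffunP => j; rewrite ffunE /=; case: eqP => [->//|/eqP ji].
    by rewrite -(eqP (implyP (yx j) ji)).
  move=> [[i c]]; rewrite inE /= => xic ->; exists i; rewrite ffunE /= eqxx.
  apply/andP; split=> //.
  by apply/forallP => j; apply/implyP => ji; rewrite ffunE (negPf ji).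
rewrite card_in_imset => [|[i c] [j d]]; last first.
  rewrite !inE /= => xic _ /ffunP/(_ i); rewrite !ffunE /= eqxx.
  case: eqP => [-> -> //|_ cE].
  by move: xic; rewrite cE /near_coord distnn.
rewrite cardE -sum1_size big_enum /=.
rewrite (eq_bigl (fun u => near_coord u.1 u.2)) => [|u]; last by rewrite inE.
rewrite -(pair_big_dep predT near_coord (fun _ _ => 1%N)) /=.
apply: eq_bigr => i _; rewrite big_mkcond !big_ord_recl big_ord0 /near_coord /=.
by case: (x i) => [[|[|[|]]]].
Qed.

(** The weight of a vertex is a product over its coordinates, so the sum over all vertices is an
    n-th power. *)
Lemma mean_isolated_P3n (R : realType) (p : R) (n : nat) :
  mean_isolated _ (P3n_adj n) _ p = ((2 - p) ^+ 2 - 1) ^+ n.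
Proof.
transitivity (\sum_(x : P3n_vertex n)
    \prod_i (1 - p) ^+ (1 + (x i == 1%N :> nat))).
  apply: eq_bigr => x _; rewrite card_incident_edges.
  - by rewrite card_P3n_neighbours expr_sum.
  - exact: P3n_adj_sym.
  - exact: P3n_adj_irr.
rewrite -(bigA_distr_bigA (fun=> fun c : 'I_3 => (1 - p) ^+ (1 + (c == 1%N :> nat)))) /=.
rewrite prodr_const card_ord !big_ord_recl big_ord0 /=; congr (_ ^+ _).
ring.
Qed.

(** * Limits and the threshold *)

Local Open Scope classical_set_scope.
Local Open Scope ring_scope.

Lemma cvg_linear_over_exp (R : realType) (a : R) : 1 < a ->
  (fun n : nat => (n.*2).+1%:R / a ^+ n) @ \oo --> (0 : R).
Proof.
(* As [a ^+ n] is [b ^+ n] squared, one factor absorbs the linear numerator by Bernoulli and the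
   other still forces decay. *)
move=> a1; pose b := Num.sqrt a.
have b1 : 1 < b by rewrite -sqrtr1 ltr_sqrt //; lra.
have ab : a = b ^+ 2 by rewrite sqr_sqrtr //; lra.
have b0 : 0 < b by lra.
have bern (n : nat) : 1 + n%:R * (b - 1) <= b ^+ n.
  elim: n => [|n IHn]; first by rewrite mul0r addr0.
  rewrite exprS; apply: le_trans (ler_wpM2l (ltW b0) IHn).
  rewrite -natr1 -subr_ge0.
  rewrite (_ : _ - _ = n%:R * (b - 1) ^+ 2); last by ring.
  by rewrite mulr_ge0 ?ler0n ?sqr_ge0.
(* The constant works because (b + 1)(1 + n(b - 1)) - (2n + 1)(b - 1) = 2 + n(b - 1)^2. *)
apply: (@squeeze_cvgr _ _ _ _ (fun=> 0) (geometric ((b + 1) / (b - 1)) b^-1)).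
- apply: nearW => n; have t0 : 0 < b ^+ n by exact: exprn_gt0.
  rewrite divr_ge0 ?exprn_ge0 ?ler0n //=; last lra.
  rewrite ab exprAC expr2 exprVn ler_pdivrMr ?mulr_gt0 //.
  rewrite [leRHS](_ : _ = (b + 1) * b ^+ n / (b - 1)); last first.
    by field; apply/andP; split; lra.
  rewrite ler_pdivlMr; last lra.
  have b1_ge0 : 0 <= b + 1 by lra.
  apply: le_trans (ler_wpM2l b1_ge0 (bern n)).
  rewrite -natr1 -muln2 natrM -subr_ge0.
  rewrite (_ : _ - _ = 2 + n%:R * (b - 1) ^+ 2); last by ring.
  by apply: addr_ge0; rewrite // mulr_ge0 ?ler0n ?sqr_ge0.
- exact: cvg_cst.
- apply: cvg_geometric; rewrite ger0_norm ?invr_ge0 ?(ltW b0) //.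
  by rewrite invf_lt1.
Qed.

Theorem mainTheorem4 (R : realType) (p : R) (hp0 : 0 < p) (hp1 : p < 1) :
  (p < 2 - Num.sqrt 2 ->
     (fun n : nat => subgraph_prob (P3n_adj n) p (@connected_graph (P3n_vertex n)))
       @ \oo --> (0 : R)) /\
  (2 - Num.sqrt 2 < p ->
     (fun n : nat => subgraph_prob (P3n_adj n) p (@no_isolated_vertex (P3n_vertex n)))
       @ \oo --> (1 : R)).
Proof.
have [p0 p1] := (ltW hp0, ltW hp1).
have s0 : 0 <= Num.sqrt (2 : R) by exact: sqrtr_ge0.
have s2 : Num.sqrt (2 : R) ^+ 2 = 2 by rewrite sqr_sqrtr.
set a := (2 - p) ^+ 2 - 1; split=> hp.
- have a1 : 1 < a by rewrite /a; nra.
  apply: (squeeze_cvgr _ (cvg_cst 0) (cvg_linear_over_exp _ _ a1)).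
  (* For n = 0 the graph is a single vertex, at once connected and isolated. *)
  near=> n; have n_gt0 : (0 < n)%N by near: n; exact: nbhs_infty_gt.
  rewrite subgraph_prob_ge0 //=.
  apply: le_trans (_ : _ <= subgraph_prob (P3n_adj n) p (@no_isolated_vertex _)) _.
    apply: le_subgraph_prob => // S; apply: connected_graph_no_isolated_vertex => //.
    by rewrite [X in (1 < X)%N]card_ffun !card_ord -{1}(expn0 3) ltn_exp2l.
  rewrite -mean_isolated_P3n; apply: prob_no_isolated_vertex_le => //.
  + exact: P3n_adj_sym.
  + exact: P3n_adj_irr.
  + by rewrite mean_isolated_P3n exprn_gt0 // (lt_trans ltr01).
  + move=> x; rewrite card_incident_edges ?card_P3n_neighbours;
      [| exact: P3n_adj_sym | exact: P3n_adj_irr].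
    apply: leq_trans (_ : \sum_(i < n) 2 <= _)%N; last first.
      by rewrite sum_nat_const card_ord muln2.
    by apply: leq_sum => i _; rewrite -[2%N]/(1 + 1)%N leq_add2l leq_b1.
(* Here 1 < 2 - p < sqrt 2, so [a] lies in [0, 1) and its powers vanish in the limit. *)
- have a0 : 0 <= a by rewrite /a; nra.
  have a1 : a < 1 by rewrite /a; nra.
  apply: (@squeeze_cvgr _ _ _ _ (fun n : nat => 1 - a ^+ n) (fun=> 1)).
  + apply: nearW => n; rewrite subgraph_prob_le1 // andbT.
    rewrite -mean_isolated_P3n; exact: prob_no_isolated_vertex_ge.
  + rewrite -[X in _ --> X]subr0; apply: cvgB; first exact: cvg_cst.
    by apply: cvg_expr; rewrite ger0_norm.
  + exact: cvg_cst.
Unshelve. all: by end_near.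
Qed.
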